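(* Let $(e_1,\dots,e_d)$ be the canonical basis of $\mathbb{R}^d$ and consider the root system $R=\{\pm e_i:\ 1\le i\le d\}$. Let $D$ be a bounded open subset of $\mathbb{R}^d$ and let $z\in\partial D$. Assume that there exists a cone $C$ with vertex $z$ such that $C\cap B(z,r)\subset D^c$ for some $r>0$. Then $z$ is regular for $D$, i.e. $P^z[\tau_D=0]=1$.
   Context: Setting. Let $d\ge1$, $R=\{\pm e_i:1\le i\le d\}$, $R_+=\{e_1,\dots,e_d\}$. The reflection $\sigma_{e_i}$ changes the sign of the $i$-th coordinate, and $W$ is the group generated by $\sigma_{e_1},\dots,\sigma_{e_d}$. The multiplicity function is given by arbitrary numbers $k_i=k(e_i)=k(-e_i)\ge0$, $1\le i\le d$. Put $\gamma=\sum_{i=1}^dk_i$, $\lambda=\gamma+\frac d2-1$, and assume $\lambda>0$. Put $w_k(y)=\prod_{i=1}^d|y_i|^{2k_i}$. Dunkl operators: $T_if(x)=\frac{\partial f}{\partial x_i}(x)+k_i\frac{f(x)-f(\sigma_{e_i}x)}{x_i}$ (extended by continuity to $x_i=0$). The Dunkl Laplacian is $\Delta_k=\sum_{i=1}^dT_i^2$. The Dunkl kernel $E_k(\cdot,y)$, for $y\in\mathbb{R}^d$, is the unique real-analytic solution on $\mathbb{R}^d$ of $T_iF=y_iF$ ($1\le i\le d$), $F(0)=1$. The Dunkl process $X=(\Omega,\mathcal F,\mathcal F_t,X_t,P^x)$ is the càdlàg (Hunt) Markov process on $\mathbb{R}^d$ with transition semigroup $P_t^k(x,dy)=p_t^k(x,y)w_k(y)dy$,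 where $$p_t^k(x,y)=\frac{1}{c_kt^{\gamma+d/2}}\exp\left(-\frac{|x|^2+|y|^2}{2t}\right)E_k\left(\frac{x}{\sqrt t},\frac{y}{\sqrt t}\right),\qquad c_k=\int_{\mathbb{R}^d}e^{-|y|^2/2}w_k(y)\,dy;$$ its generator is $\frac12\Delta_k$. For a bounded open set $D$, $\tau_D=\inf\{t>0:X_t\notin D\}$. A point $z\in\partial D$ is regular for $D$ if $P^z[\tau_D=0]=1$. $D^c=\mathbb{R}^d\setminus D$, and $B(z,r)$ is the Euclidean ball of center $z$ and radius $r$. A cone with vertex $z$ means a set $C\subset\mathbb{R}^d$ with nonempty interior such that $z+s(y-z)\in C$ for all $y\in C$ and all $s>0$. *)

(* Defs.v *)
From HB Require Import structures.
From mathcomp Require Import all_boot all_order all_algebra.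
From mathcomp Require Import all_classical all_reals all_analysis.
From mathcomp Require Import measurable_realfun.

Set Implicit Arguments.
Unset Strict Implicit.
Unset Printing Implicit Defensive.

Import Order.TTheory GRing.Theory Num.Theory.
Import numFieldNormedType.Exports.

Local Open Scope classical_set_scope.
Local Open Scope ring_scope.

(* MathComp-Analysis has no measurable structure on matrices: we equip them
   with the Borel sigma-algebra. *)
HB.instance Definition _ (R : realType) (m n : nat) :=
  Measurable.copy 'M[R]_(m, n) (g_sigma_algebraType (@open 'M[R]_(m, n))).

Section borel_row.
Context {R : realType}.

Lemma open_measurable_mx m n (U : set 'M[R]_(m, n)) : open U -> measurable U.
Proof. by move=> oU; apply: sub_sigma_algebra. Qed.

Lemma continuous_measurable_mx m n (f : 'M[R]_(m, n) -> R) :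
  continuous f -> measurable_fun setT f.
Proof.
move=> cf; apply: (measurability _ (RGenOInfty.measurableE R)).
move=> _ [_ [a ->] <-]; rewrite setTI; apply: open_measurable_mx.
by move/continuousP: cf; apply; exact: interval_open.
Qed.

Lemma continuous_measurable_mx2 m n p q (f : 'M[R]_(m, n) -> 'M[R]_(p, q)) :
  continuous f -> measurable_fun setT f.
Proof.
move=> cf; apply: (@measurability _ _ _ _ setT f open) => //.
move=> _ [U oU <-]; rewrite setTI; apply: open_measurable_mx.
by move/continuousP: cf; apply.
Qed.

Definition consr n (p : R * 'rV[R]_n) : 'rV[R]_n.+1 :=
  row_mx (const_mx p.1 : 'rV_1) p.2.

Lemma measurable_consr n : measurable_fun setT (@consr n).
Proof.
apply: (@measurability _ _ _ _ setT (@consr n) open) => //.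
move=> _ [V oV <-]; rewrite setTI.
pose e (k : nat) : R := k.+1%:R^-1.
have e0 k : 0 < e k by rewrite invr_gt0 ltr0n.
pose Q (i : rat * 'rV[rat]_n * nat) : set (R * 'rV[R]_n) :=
  ball (ratr i.1.1 : R) (e i.2) `*` ball (map_mx ratr i.1.2 : 'rV[R]_n) (e i.2).
pose F i := if `[< Q i `<=` @consr n @^-1` V >] then Q i else set0.
have -> : @consr n @^-1` V = \bigcup_i F i.
  apply/seteqP; split=> [[x v] /= Vxv|p [i _]]; last first.
    by rewrite /F; case: asboolP => // h /h.
  have [eps /= eps0 hV] : nbhs_ball (consr (x, v)) V.
    by rewrite nbhs_ballE; exact: open_nbhs_nbhs.
  have [k hk] : exists k, e k < eps / 2.
    have := near_infty_natSinv_lt (PosNum (divr_gt0 eps0 (ltr0n _ 2))).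
    by case=> k _ /(_ k (leqnn k)) /= ?; exists k.
  have app (y : R) : {q : rat | `|y - ratr q| < e k}.
    apply: cid.
    have /rat_in_itvoo[q] : y - e k < y + e k.
      by rewrite ltrD2l (lt_trans _ (e0 k))// oppr_lt0.
    rewrite in_itv /= => /andP[q1 q2]; exists q.
    by rewrite ltr_distlC q1.
  pose i := (sval (app x), (\row_j sval (app (v 0 j)))%R : 'rV[rat]_n, k).
  have Qi : Q i (x, v).
    split; rewrite /i /=.
      by rewrite /ball/= distrC; exact: (svalP (app x)).
    split=> // a b; rewrite !mxE (ord1 a) /ball /= distrC.
    exact: (svalP (app (v 0 b))).
  exists i => //; rewrite /F; case: asboolP => //; case=> [[y u]] /= [] /=.
  rewrite /i /= => hy [_ hu]; apply: hV; split=> // a b.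
  case: Qi => /= hx [_ hv].
  have tri (s t r : R) : ball r (e k) s -> ball r (e k) t -> ball s eps t.
    move=> rs rt; have -> : eps = eps / 2 + eps / 2 by rewrite -splitr.
    apply: (@ball_triangle _ _ r); last exact: le_ball (ltW hk) _ rt.
    by apply: ball_sym; exact: le_ball (ltW hk) _ rs.
  rewrite /consr /= !mxE; case: splitP => j _.
    by rewrite !mxE; exact: tri hx hy.
  rewrite (ord1 a).
  by have /= := hv 0 j; have /= := hu 0 j => h1 h2; exact: tri h2 h1.
apply: countable_bigcupT_measurable; first exact: countableP.
move=> i; rewrite /F; case: asboolP => _; last exact: measurable0.
apply: measurableX; first by apply: open_measurable; exact: ball_open.
by apply: open_measurable_mx; exact: ball_open.
Qed.


Definition unconsr n (v : 'rV[R]_n.+1) : R * 'rV[R]_n :=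
  (v 0 0, \row_j v 0 (lift ord0 j)).

Lemma consrK n : cancel (@consr n) (@unconsr n).
Proof.
move=> [x v]; rewrite /unconsr /consr /=; congr pair.
  by rewrite mxE; case: splitP => // j _; rewrite mxE.
apply/rowP => j; rewrite !mxE.
case: splitP => k /= => [|/eqP]; first by rewrite (ord1 k).
by rewrite /bump /= eqSS => /eqP jk; congr (v 0 _); exact/val_inj.
Qed.

Lemma measurable_unconsr n : measurable_fun setT (@unconsr n).
Proof.
apply: measurable_fun_pair; first by apply: continuous_measurable_mx; exact: coord_continuous.
apply: continuous_measurable_mx2 => v P /= /nbhs_ballP[e e0 eP].
apply/nbhs_ballP; exists e => //= w [_ vw]; apply: eP.
by split=> // i j; rewrite !mxE; exact: vw.
Qed.

Section lebesgue_step.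
Variables (n : nat) (m : {sigma_finite_measure set 'rV[R]_n -> \bar R}).

Definition lebesgue_step : set 'rV[R]_n.+1 -> \bar R :=
  pushforward (lebesgue_measure \x m)%E (@consr n).

HB.instance Definition _ := Measure.copy lebesgue_step
  (measure_function_pushforward__canonical__measure_function_Measure
     (lebesgue_measure \x m)%E (@measurable_consr n)).

Lemma lebesgue_step_sigma_finite : sigma_finite setT lebesgue_step.
Proof.
have /sigma_finiteP[F [FT ndF Foo]] := sigma_finiteT (@lebesgue_measure R).
have /sigma_finiteP[G [GT ndG Goo]] := sigma_finiteT m.
exists (fun k => @unconsr n @^-1` (F k `*` G k)).
  apply/esym; rewrite -preimage_bigcup -subTset => v _.
  have [i _ Fi] : (\bigcup_i F i) (unconsr v).1 by rewrite -FT.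
  have [j _ Gj] : (\bigcup_i G i) (unconsr v).2 by rewrite -GT.
  exists (maxn i j) => //; split.
    by move: Fi; exact/subsetPset/ndF/leq_maxl.
  by move: Gj; exact/subsetPset/ndG/leq_maxr.
move=> k; have [mF Fk] := Foo k; have [mG Gk] := Goo k; split.
  by rewrite -[X in measurable X]setTI; apply: measurable_unconsr => //;
    exact: measurableX.
rewrite /lebesgue_step /pushforward -comp_preimage.
rewrite (_ : @unconsr n \o @consr n = id); last first.
  by apply/funext => p; exact: consrK.
by rewrite preimage_id product_measure1E// lte_mul_pinfty// ge0_fin_numE.
Qed.

HB.instance Definition _ :=
  Measure_isSigmaFinite.Build _ _ _ lebesgue_step lebesgue_step_sigma_finite.

End lebesgue_step.

(* Lebesgue measure on R^n, as the n-fold product of the one-dimensional one. *)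
Fixpoint lebesgue_rV n : {sigma_finite_measure set 'rV[R]_n -> \bar R} :=
  match n with
  | 0 => \d_(0 : 'rV[R]_0)
  | n'.+1 => lebesgue_step (lebesgue_rV n')
  end.

End borel_row.

Section euclidean.
Context {R : realType} {d : nat}.
Implicit Types (x y z : 'rV[R]_d) (A : set 'rV[R]_d).

(* The library norm `|x| on row vectors is the sup norm. *)
Definition enorm x : R := Num.sqrt (\sum_i x 0 i ^+ 2).

Definition eball z (r : R) : set 'rV[R]_d := [set y | enorm (y - z) < r].

Definition frontier A : set 'rV[R]_d := closure A `\` A°.

Definition cone_with_vertex z A : Prop :=
  A° !=set0 /\ forall y (s : R), A y -> 0 < s -> A (z + s *: (y - z)).

(* f is, around each point a, the sum of an absolutely convergent power series
   in x - a indexed by multi-indices; the signed sum is written as the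
   difference of the sums of the positive and of the negative parts. *)
Definition real_analytic (f : 'rV[R]_d -> R) : Prop :=
  forall a, exists (c : {ffun 'I_d -> nat} -> R) (r : R), 0 < r /\
    forall x, ball a r x ->
      let u (al : {ffun 'I_d -> nat}) : \bar R :=
        (c al * \prod_i (x 0 i - a 0 i) ^+ al i)%:E in
      summable setT u /\
      ((f x)%:E = \esum_(al in setT) u^\+ al - \esum_(al in setT) u^\- al)%E.

End euclidean.

Section dunkl.
Context {R : realType} {d : nat}.
Variable k : 'I_d -> R.
Implicit Types (x y z : 'rV[R]_d) (t s : R).

Definition gammak : R := \sum_i k i.

Definition lambdak : R := gammak + d%:R / 2 - 1.

Definition weight y : R := \prod_i `|y 0 i| `^ (2 * k i).

Definition reflection (i : 'I_d) x : 'rV[R]_d :=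
  \row_j (if j == i then - x 0 j else x 0 j).

Definition diff_quotient (i : 'I_d) (f : 'rV[R]_d -> R) x : R :=
  (f x - f (reflection i x)) / x 0 i.

Definition dunkl_op (i : 'I_d) (f : 'rV[R]_d -> R) x : R :=
  let e : 'rV[R]_d := delta_mx 0 i in
  'D_e f x + k i * (if x 0 i == 0
                    then lim (diff_quotient i f (x + h *: e) @[h --> 0^'])
                    else diff_quotient i f x).

(* E x y stands for E_k(x, y). *)
Definition is_dunkl_kernel (E : 'rV[R]_d -> 'rV[R]_d -> R) : Prop :=
  forall y, [/\ real_analytic (E^~ y),
                forall i x, dunkl_op i (E^~ y) x = y 0 i * E x y
              & E 0 y = 1].

Definition dunkl_cst : R :=
  \int[lebesgue_rV d]_y (expR (- (enorm y ^+ 2 / 2)) * weight y).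

Variable E : 'rV[R]_d -> 'rV[R]_d -> R.

Definition dunkl_density t x y : R :=
  (dunkl_cst * t `^ (gammak + d%:R / 2))^-1 *
  expR (- ((enorm x ^+ 2 + enorm y ^+ 2) / (2 * t))) *
  E ((Num.sqrt t)^-1 *: x) ((Num.sqrt t)^-1 *: y).

Definition dunkl_semigroup t x (B : set 'rV[R]_d) : \bar R :=
  (\int[lebesgue_rV d]_(y in B) (dunkl_density t x y * weight y)%:E)%E.

End dunkl.

Section process.
Context {R : realType} {d : nat} {dO : measure_display}
  {Omega : measurableType dO}.
Implicit Types (F : R -> set (set Omega)) (X : R -> Omega -> 'rV[R]_d)
  (P : 'rV[R]_d -> probability Omega R) (T : Omega -> \bar R).

(* Time is [0, +oo[; the values of F and X at negative times are irrelevant. *)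
Definition filtration F : Prop :=
  [/\ forall t, 0 <= t -> sigma_algebra setT (F t),
      forall t, 0 <= t -> F t `<=` measurable
    & forall s t, 0 <= s -> s <= t -> F s `<=` F t].

Definition right_continuous_filtration F : Prop :=
  forall t, 0 <= t -> F t = \bigcap_(s in [set s | t < s]) F s.

Definition adapted F X : Prop :=
  forall t (B : set 'rV[R]_d), 0 <= t -> measurable B -> F t (X t @^-1` B).

Definition cadlag X : Prop := forall w t,
  (0 <= t -> X s w @[s --> t^'+] --> X t w) /\
  (0 < t -> cvg (X s w @[s --> t^'-])).

Definition stopping_time F T : Prop :=
  (forall w, 0 <= T w)%E /\
  forall t, 0 <= t -> F t [set w | (T w <= t%:E)%E].

Definition stopped_sigma_algebra F T : set (set Omega) :=
  [set A | measurable A /\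
    forall t, 0 <= t -> F t (A `&` [set w | (T w <= t%:E)%E])].

Definition strong_markov (Q : R -> 'rV[R]_d -> set 'rV[R]_d -> \bar R) F X P :
    Prop :=
  forall x T s (A : set Omega) (B : set 'rV[R]_d),
    stopping_time F T -> 0 < s -> stopped_sigma_algebra F T A ->
    measurable B ->
    let A' := A `&` [set w | (T w < +oo)%E] in
    P x (A' `&` [set w | B (X (fine (T w) + s) w)]) =
    (\int[P x]_(w in A') Q s (X (fine (T w)) w) B)%E.

Definition quasi_left_continuous F X P : Prop :=
  forall x (T_ : nat -> Omega -> \bar R),
    (forall n, stopping_time F (T_ n)) ->
    (forall n w, T_ n w <= T_ n.+1 w)%E ->
    let T w := ereal_sup (range (T_ ^~ w)) in
    {ae P x, forall w, (T w < +oo)%E ->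
      X (fine (T_ n w)) w @[n --> \oo] --> X (fine (T w)) w}.

(* The (simple) Markov property is the case of constant stopping times of
   strong_markov. The filtration is not required to be complete. *)
Record is_hunt_process (Q : R -> 'rV[R]_d -> set 'rV[R]_d -> \bar R) F X P :
    Prop := {
  hunt_filtration : filtration F ;
  hunt_right_continuous : right_continuous_filtration F ;
  hunt_adapted : adapted F X ;
  hunt_cadlag : cadlag X ;
  hunt_start : forall x, {ae P x, forall w, X 0 w = x} ;
  hunt_strong_markov : strong_markov Q F X P ;
  hunt_quasi_left_continuous : quasi_left_continuous F X P }.

Definition exit_time X (D : set 'rV[R]_d) (w : Omega) : \bar R :=
  ereal_inf [set t%:E | t in [set t : R | 0 < t /\ ~ D (X t w)]].

(* P^z[tau_D = 0] = 1: the event is in general only measurable with respect to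
   the completed sigma-algebra, whence the almost sure formulation. *)
Definition regular_point X P (D : set 'rV[R]_d) z : Prop :=
  {ae P z, forall w, exit_time X D w = 0%E}.

End process.

(* Main.v *)
Require Import Defs.
From HB Require Import structures.
From mathcomp Require Import all_boot all_order all_algebra.
From mathcomp Require Import all_classical all_reals all_analysis.
From mathcomp Require Import measurable_realfun ring lra.

Set Implicit Arguments.
Unset Strict Implicit.
Unset Printing Implicit Defensive.

Import Order.TTheory GRing.Theory Num.Theory.
Import numFieldNormedType.Exports.

Local Open Scope classical_set_scope.
Local Open Scope ring_scope.

(** Cones are invariant under scaling about their vertex, and the Dunkl process
    has Brownian scaling. This makes the process started at the vertex charge
    the cone with a probability bounded below at every small time.

    Choose an open sup-norm ball of centre [q] and radius [e] whose translate
    by [z] lies in the cone and which stays away from the coordinate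
    hyperplanes. By the cone property [B_s = ball (z + s *: q) (s * e)] is
    disjoint from [D] for small [s]. The main estimate,
    [dunkl_semigroup_scaled_ball_ge], is that
    [P_(s^2)(z, B_s) >= c] with [c > 0] independent of [s]. A zero-one argument
    at time 0 ([hits_infinitely_often]) then shows that, for a sequence [s_n]
    tending to 0, almost surely [X] is in [B_(s_n)] at time [s_n^2] for
    infinitely many [n], so that the exit time of [D] vanishes.

    The estimate needs a lower bound on the Dunkl kernel which decays no faster
    than the weight grows. As a function of the [i]-th coordinate of its
    first argument, [E] solves the rank-one equation
    [f'(x) + a (f(x) - f(-x)) / x = y f(x)] with [a = k i] and [y] the [i]-th
    coordinate of the second argument. Any solution with [f(0) > 0] satisfies
    [f(x) >= f(0) exp(xy - 1) max(1, xy)^(-a)] for [xy >= 0]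
    ([dunkl_ode_lower_bound]). Switching on the coordinates of [x] one after
    the other, starting from [E 0 y = 1], gives the product of these bounds
    ([dunkl_kernel_ge]), without identifying [E] explicitly. For
    [y = z + s u] the exponential completes the Gaussian factor to
    [exp(- u^2 / 2)], and [max(1, z y / s^2)^(-a)] compensates
    [|y|^(2a) / s^(2a)] whether [z i] vanishes or not
    ([coordinate_density_ge]). *)

(** * Positive solutions of the rank-one Dunkl equation *)

Section rank_one.
Context {R : realType}.
Implicit Types (f df : R -> R) (x u v : R).

Lemma is_derive_continuous f df : (forall x : R, is_derive x 1 f (df x)) ->
  continuous f.
Proof.
by move=> fdf x; apply: differentiable_continuous; apply/derivable1_diffP;
   apply: ex_derive.
Qed.

Lemma is_derive_ge0_le f df (a b : R) :
  (forall x : R, a <= x -> is_derive x 1 f (df x)) ->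
  (forall x, a < x -> x < b -> 0 <= df x) -> a <= b -> f a <= f b.
Proof.
move=> fdf df0 ab.
apply: (@ger0_derive1_ndecr R f a b) => //.
- move=> x; rewrite in_itv/= => /andP[ax _].
  by have ? := fdf x (ltW ax); exact: ex_derive.
- move=> x; rewrite in_itv/= => /andP[ax xb].
  by rewrite derive1E; have [_ ->] := fdf x (ltW ax); exact: df0.
- apply: derivable_within_continuous => x; rewrite in_itv/= => /andP[ax _].
  by have ? := fdf x ax; exact: ex_derive.
Qed.

(** A barrier principle: between the last point where [f >= 0] and a later
    point where [f < 0], [f] would be negative, hence nondecreasing. *)
Lemma ge0_of_is_derive_ge0_when_lt0 f df : (forall x : R, is_derive x 1 f (df x)) ->
  0 <= f 0 -> (forall x, 0 < x -> f x < 0 -> 0 <= df x) ->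
  forall x, 0 <= x -> 0 <= f x.
Proof.
move=> fdf f0 df0 b b0; rewrite leNgt; apply/negP => fb.
pose S := `[0, b] `&` f @^-1` [set y | 0 <= y].
have cS : compact S.
  apply: (subclosed_compact _ (@segment_compact R 0 b)); last by move=> x [].
  apply: closedI; first exact: interval_closed.
  apply: preimage_closed; last exact: closed_ge.
  by move=> x _; exact: (is_derive_continuous fdf).
have S0 : S !=set0 by exists 0; split => //=; rewrite in_itv/= lexx.
(* The last point of [0, b] where f is nonnegative. *)
have [|c + cmax] := @compact_EVT_max _ R id S S0 cS.
  by apply: continuous_subspaceT => x; exact: cvg_id.
rewrite inE => -[/=]; rewrite in_itv/= => /andP[c0 cb] fc.
suff : f c <= f b by move=> /(le_trans fc); rewrite leNgt fb.
apply: (is_derive_ge0_le (df := df)) => // x cx xb.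
apply: df0; first exact: le_lt_trans cx.
rewrite ltNge; apply/negP => fx.
have : x <= c.
  apply: (cmax x); rewrite inE; split => //=.
  by rewrite in_itv/= (ltW xb) (le_trans c0 (ltW cx)).
by rewrite leNgt cx.
Qed.

(** Up to a constant, the behaviour at infinity of the rank-one Dunkl kernel
    as a function of the product [s] of its arguments. The shift by 1 in the
    exponential makes the bound valid with constant 1 from [s = 0] on. *)
Definition dunkl_minorant (a s : R) : R := expR (s - 1) * (Num.max 1 s `^ a)^-1.

Section ode.
Variables (f df : R -> R) (a y : R).
Hypothesis a0 : 0 <= a.
Hypothesis y0 : 0 <= y.
Hypothesis fdf : forall x : R, is_derive x 1 f (df x).
Hypothesis fode : forall x, x != 0 -> df x + a * ((f x - f (- x)) / x) = y * f x.
Hypothesis f0 : 0 < f 0.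

Let g x := (f x + f (- x)) / 2.
Let h x := (f x - f (- x)) / 2.
Let dg x := (df x - df (- x)) / 2.
Let dh x := (df x + df (- x)) / 2.

Let fNdf (x : R) : is_derive x 1 (fun x => f (- x)) (- df (- x)).
Proof.
have d1 := fdf (- x).
have := @is_derive1_comp R f -%R x (df (- x)) (-1) d1 (is_deriveNid _ _).
by rewrite mulrN1.
Qed.

Let gdg (x : R) : is_derive x 1 g (dg x).
Proof.
have ? := fdf x; have ? := fNdf x.
rewrite (_ : g = 2^-1 \*: (f + (fun x => f (- x)))); last first.
  by apply/funext => u; rewrite /g mulrC.
by apply: is_derive_eq; rewrite /dg/= /GRing.scale/= mulrC.
Qed.

Let hdh (x : R) : is_derive x 1 h (dh x).
Proof.
have ? := fdf x; have ? := fNdf x.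
rewrite (_ : h = 2^-1 \*: (f - (fun x => f (- x)))); last first.
  by apply/funext => u; rewrite /h mulrC.
by apply: is_derive_eq; rewrite /dh/= /GRing.scale/= opprK mulrC.
Qed.

(* For [x > 0] the equation splits into the system
   [g' = y h], [h' = y g - 2 a h / x] on the even and odd parts. *)
Let dgE x : 0 < x -> dg x = y * h x.
Proof.
move=> x0; have xn : x != 0 by rewrite gt_eqF.
have := fode xn; have := fode (x := - x); rewrite oppr_eq0 => /(_ xn).
rewrite opprK invrN /dg /h => e1 e2.
rewrite (_ : df x = y * f x - a * ((f x - f (- x)) / x)); last by rewrite -e2 addrK.
rewrite (_ : df (- x) = y * f (- x) - a * ((f (- x) - f x) * - x^-1)); last by rewrite -e1 addrK.
by field.
Qed.

Let dhE x : 0 < x -> dh x = y * g x - 2 * a / x * h x.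
Proof.
move=> x0; have xn : x != 0 by rewrite gt_eqF.
have := fode xn; have := fode (x := - x); rewrite oppr_eq0 => /(_ xn).
rewrite opprK invrN /dh /h /g => e1 e2.
rewrite (_ : df x = y * f x - a * ((f x - f (- x)) / x)); last by rewrite -e2 addrK.
rewrite (_ : df (- x) = y * f (- x) - a * ((f (- x) - f x) * - x^-1)); last by rewrite -e1 addrK.
by field.
Qed.

Let h0 : h 0 = 0. Proof. by rewrite /h oppr0 subrr mul0r. Qed.
Let g0 : g 0 = f 0. Proof. by rewrite /g oppr0; lra. Qed.

(* The product satisfies [(g h)' = y (g^2 + h^2) - (2 a / x) g h], so it cannot
   decrease where it is negative. *)
Let gh_ge0 x : 0 <= x -> 0 <= g x * h x.
Proof.
apply: (@ge0_of_is_derive_ge0_when_lt0 (fun x => g x * h x)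
  (fun x => g x * dh x + h x * dg x)) => {x} [x||x x0 gh].
- by have ? := gdg x; have ? := hdh x; exact: is_deriveM.
- by rewrite h0 mulr0.
rewrite dgE// dhE// (_ : _ + _ =
  y * (g x ^+ 2 + h x ^+ 2) - 2 * a / x * (g x * h x)); last by ring.
rewrite addr_ge0//; first by rewrite mulr_ge0// addr_ge0// sqr_ge0.
by rewrite oppr_ge0 mulr_ge0_le0// ?(ltW gh)// !mulr_ge0// invr_ge0 ltW.
Qed.

(* [(g^2)' = 2 y g h >= 0], so [g] stays away from 0 and keeps its sign. *)
Let g_ge x : 0 <= x -> f 0 <= g x.
Proof.
move=> x0.
have sq u : 0 <= u -> f 0 ^+ 2 <= g u ^+ 2.
  move=> u0; rewrite -g0.
  apply: (@is_derive_ge0_le (fun x => g x ^+ 2) (fun x => 2 * (g x * dg x))) => //.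
    move=> v _; have ? := gdg v.
    rewrite (_ : (fun x => g x ^+ 2) = g * g); last by apply/funext => w; rewrite expr2.
    by apply: is_derive_eq; rewrite /GRing.scale/=; ring.
  move=> v v0 _; rewrite dgE// (_ : _ * _ = 2 * y * (g v * h v)); last by ring.
  by apply: mulr_ge0; [exact: mulr_ge0 | exact/gh_ge0/ltW].
suff gx : 0 <= g x by rewrite -(@ler_pXn2r _ 2)// ?nnegrE ?sq// ltW.
rewrite leNgt; apply/negP => gx.
have [||c] := @IVT R g 0 x 0 x0.
- apply: continuous_subspaceT => u; exact: (is_derive_continuous gdg).
- by rewrite g0 ge_min le_max (ltW gx) (ltW f0) orbT.
rewrite in_itv/= => /andP[c0 _] gc.
by have := sq c c0; rewrite gc expr0n/= leNgt exprn_gt0.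
Qed.

Let h_ge0 x : 0 <= x -> 0 <= h x.
Proof.
move=> x0; have := gh_ge0 x0.
by rewrite pmulr_rge0// (lt_le_trans f0)// g_ge.
Qed.

(* This is the nonnegativity of [f] on the negative half-line. *)
Let h_le_g x : 0 <= x -> h x <= g x.
Proof.
move=> x0; rewrite -subr_ge0; move: x x0.
apply: (@ge0_of_is_derive_ge0_when_lt0 (fun x => g x - h x)
  (fun x => dg x - dh x)) => [x||x x0 gh].
- by have ? := gdg x; have ? := hdh x; exact: is_deriveB.
- by rewrite h0 g0 subr0 ltW.
rewrite dgE// dhE// (_ : _ - _ = - (y * (g x - h x)) + 2 * a / x * h x); last by ring.
rewrite addr_ge0//.
  by rewrite oppr_ge0 mulr_ge0_le0// ltW.
by apply: mulr_ge0; [rewrite divr_ge0 ?mulr_ge0// ltW | exact/h_ge0/ltW].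
Qed.

Let fE x : f x = g x + h x. Proof. by rewrite /g /h; lra. Qed.

(** Since the odd part [h] is at most the even part [g], [2 h <= f] and
    [f' = y f - 2 a h / x >= (y - a / x) f]. Hence [f x * x^a * exp(- x y)] is
    nondecreasing; comparing [x] with [1 / y] gives the bound for [x y >= 1],
    and for [x y <= 1] already [f x >= f 0] is enough. *)
Lemma dunkl_ode_lower_bound_pos x : 0 <= x -> f 0 * dunkl_minorant a (x * y) <= f x.
Proof.
move=> x0; have fx u : 0 <= u -> f 0 <= f u.
  by move=> u0; rewrite (fE u) (le_trans (g_ge u0))// lerDl h_ge0.
rewrite /dunkl_minorant; have [xy|xy] := leP (x * y) 1.
  rewrite powR1 invr1 mulr1 (le_trans _ (fx _ x0))//.
  by rewrite ler_piMr ?(ltW f0)// -[leRHS]expR0 ler_expR subr_le0.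
have yp : 0 < y.
  by rewrite lt_neqAle y0 andbT; apply: contraTneq xy => <-; rewrite mulr0 -leNgt.
have xp : 0 < x.
  by rewrite lt_neqAle x0 andbT; apply: contraTneq xy => <-; rewrite mul0r -leNgt.
have xy1 : y^-1 <= x by rewrite -[leLHS]mul1r ler_pdivrMr// ltW.
pose F u := f u * (u `^ a * expR (- (u * y))).
have : F y^-1 <= F x.
  apply: (is_derive_ge0_le (df := fun u =>
      f u * (u `^ a * (- y * expR (- (u * y)))
             + expR (- (u * y)) * (a * u `^ (a - 1)))
      + u `^ a * expR (- (u * y)) * df u)) => //.
    move=> u yu; have u0 : 0 < u by rewrite (lt_le_trans _ yu)// invr_gt0.
    have ? := fdf u.
    have ? := is_derive1_powR a u0.
    have d1 : is_derive (u : R) 1 (fun v => - (v * y)) (- y).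
      rewrite (_ : (fun v => _) = - (y \*: id)); last first.
        by apply/funext => v; rewrite [v * _]mulrC.
      by apply: is_derive_eq; rewrite /GRing.scale/= mulr1.
    have d2 : is_derive (u : R) 1 (fun v => expR (- (v * y))) (- y * expR (- (u * y))).
      rewrite mulrC; exact: (is_derive1_comp (is_derive_expR _) d1).
    rewrite (_ : F = f * ((fun v => v `^ a) * (fun v => expR (- (v * y)))))//.
    exact: is_derive_eq.
  move=> u yu ux; have u0 : 0 < u by rewrite (lt_trans _ yu)// invr_gt0.
  have un : u != 0 by rewrite gt_eqF.
  have -> : a * u `^ (a - 1) = a / u * u `^ a.
    rewrite powRB; last by rewrite un implybT.
    by rewrite powRr1 ?(ltW u0)//; ring.
  have -> : df u = y * f u - 2 * a / u * h u.
    have := fode un; rewrite (_ : f u - f (- u) = 2 * h u); last by rewrite /h; lra.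
    by move=> <-; field.
  rewrite (_ : _ + _ = u `^ a * expR (- (u * y)) * (a / u) * (f u - 2 * h u)); last by field.
  rewrite fE !mulr_ge0// ?powR_ge0 ?expR_ge0 ?invr_ge0 ?(ltW u0)//.
  by have := h_le_g (ltW u0); lra.
rewrite /F mulVf ?gt_eqF// => Fx.
have xa : 0 < x `^ a * expR (- (x * y)) by rewrite mulr_gt0 ?powR_gt0 ?expR_gt0.
rewrite -(ler_pM2r xa) (le_trans _ Fx)//.
have -> : y^-1 `^ a = (y `^ a)^-1.
  by rewrite -powR_inv1// -powRrM mulN1r powRN.
rewrite [leLHS](_ : _ = f 0 * ((y `^ a)^-1 * expR (-1))); last first.
  rewrite powRM// expRD [expR (- (x * y))]expRN; field.
  by rewrite !gt_eqF ?powR_gt0 ?expR_gt0.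
rewrite ler_wpM2r//; last by apply: fx; rewrite invr_ge0.
by rewrite mulr_ge0 ?invr_ge0 ?powR_ge0 ?expR_ge0.
Qed.

End ode.
End rank_one.

Section rank_one_sign.
Context {R : realType}.

(** The equation is invariant under [(x, y) |-> (- x, - y)], which reduces the
    case of negative [x] and [y] to the previous lemma. *)
Lemma dunkl_ode_lower_bound (f df : R -> R) (a y x : R) : 0 <= a ->
  (forall u : R, is_derive u 1 f (df u)) ->
  (forall u, u != 0 -> df u + a * ((f u - f (- u)) / u) = y * f u) ->
  0 < f 0 -> 0 <= x * y -> f 0 * dunkl_minorant a (x * y) <= f x.
Proof.
move=> a0 fdf ode f0 xy0.
have [/andP[x0 y0]|xy] := boolP ((0 <= x) && (0 <= y)).
  exact: (dunkl_ode_lower_bound_pos a0 y0 fdf ode f0 x0).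
have /andP[x0 y0] : (x <= 0) && (y <= 0).
  have [x0|x0|x0] := ltgtP x 0; rewrite /=.
  - by move: xy0; rewrite nmulr_rge0.
  - by move: xy xy0; rewrite pmulr_rge0// (ltW x0) /= => /negP.
  - by move: xy; rewrite x0 lexx/= -ltNge => /ltW.
have /= := @dunkl_ode_lower_bound_pos R (fun u => f (- u)) (fun u => - df (- u))
  a (- y) a0 _ _ _ _ (- x).
rewrite mulrNN oppr0 opprK; apply => //; rewrite ?oppr_ge0//.
  move=> u; rewrite -mulrN1.
  exact: (@is_derive1_comp R f -%R u _ (-1) (fdf (- u)) (is_deriveNid _ _)).
move=> u u0; have := ode (- u); rewrite oppr_eq0 => /(_ u0).
by rewrite mulNr => <-; rewrite !opprK invrN; ring.
Qed.
End rank_one_sign.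

(** * Partial derivatives of real analytic functions *)

Section analytic.
Context {R : realType}.

Lemma esum_set2 (T : choiceType) (x y : T) (f : T -> \bar R) : x != y ->
  (forall t, 0 <= f t)%E -> (\esum_(t in [set x; y]) f t = f x + f y)%E.
Proof.
move=> xy f0; rewrite (esumID [set x])//.
rewrite (_ : _ `&` _ = [set x]); last by apply/seteqP; split=> t /=; tauto.
rewrite (_ : _ `&` _ = [set y]); last first.
  apply/seteqP; split=> t /= => [|->]; first tauto.
  by split; [right | move=> yx; rewrite yx eqxx in xy].
by rewrite !esum_set1.
Qed.

Lemma le_esum_scale (T : choiceType) (D : set T) (f g : T -> \bar R) (k : R) :
  0 <= k -> (forall t, 0 <= g t)%E -> (forall t, D t -> f t <= k%:E * g t)%E ->
  (\esum_(t in D) f t <= k%:E * \esum_(t in setT) g t)%E.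
Proof.
move=> k0 g0 fg; apply: ge_ereal_sup => /= _ [X [finX XD] <-].
apply: (@le_trans _ _ (\sum_(t \in X) k%:E * g t)%E).
  by apply: lee_fsum => // t /XD; exact: fg.
rewrite -ge0_mule_fsumr// lee_wpmul2l ?lee_fin//.
by apply: ereal_sup_ubound; exists X => //; split.
Qed.

Let ereal_split_bound (A B a b c e : \bar R) (s : R) :
  (0 <= A -> 0 <= B -> 0 <= a -> 0 <= b -> 0 <= c -> 0 <= e ->
  a + b + A + (c + e + B) < +oo -> s%:E = a + b + A - (c + e + B) ->
  `|s%:E - (a - c) - (b - e)| <= A + B)%E.
Proof.
move: A B a b c e => [A||] // [B||] // [a||] // [b||] // [c||] // [e||] //.
move=> A0 B0 a0 b0 c0 e0 _ /= [->].
have {}A0 : (0 <= A)%R by []. have {}B0 : (0 <= B)%R by [].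
by rewrite lee_fin ler_norml; apply/andP; split; lra.
Qed.

(** Peeling two terms off an absolutely convergent signed sum: for a power
    series and its terms of degree 0 and 1, this estimates the Taylor
    remainder. *)
Lemma esum_posneg_two_terms (T : choiceType) (u : T -> \bar R) (x y : T) (s : R) :
  x != y -> summable setT u ->
  (s%:E = \esum_(t in setT) u^\+ t - \esum_(t in setT) u^\- t)%E ->
  (`| s%:E - u x - u y | <= \esum_(t in ~` [set x; y]) `|u t|)%E.
Proof.
move=> xy su.
have su' : (\esum_(t in setT) (u^\+ t + u^\- t) < +oo)%E.
  apply: le_lt_trans su; apply: le_esum => t _.
  by rewrite -/((abse \o u) t) fune_abse.
rewrite (_ : \esum_(t in _) `|u t| =
   \esum_(t in ~` [set x; y]) u^\+ t + \esum_(t in ~` [set x; y]) u^\- t)%E; last first.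
  rewrite -esumD//; apply: eq_esum => t _.
  by rewrite -/((abse \o u) t) fune_abse.
rewrite (congr1 (@^~ x) (funeposneg u)) (congr1 (@^~ y) (funeposneg u)).
move: su'; rewrite esumD//.
rewrite !(esumID [set x; y] setT) // !setTI !esum_set2//.
by apply: ereal_split_bound; rewrite ?esum_ge0.
Qed.

(** On the line through [a] in direction [e_i] only the monomials in the
    [i]-th variable survive. Compared with their values at a fixed [h0] inside
    the domain of convergence, those of degree at least 2 have a sum of order
    [(h / h0) ^ 2]. Differentiability at the centre is enough because the
    centre is arbitrary. *)
Lemma real_analytic_derivable d (F : 'rV[R]_d -> R) (i : 'I_d) (a : 'rV[R]_d) :
  real_analytic F -> derivable F a (delta_mx 0 i).
Proof.
move=> /(_ a)[c [r [r0 Fr]]].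
set e : 'rV[R]_d := delta_mx 0 i.
pose al0 : {ffun 'I_d -> nat} := [ffun=> 0%N].
pose al1 : {ffun 'I_d -> nat} := [ffun j => (j == i) : nat].
have al01 : al0 != al1.
  by apply/eqP => /ffunP/(_ i); rewrite !ffunE eqxx.
pose b (al : {ffun 'I_d -> nat}) : R := c al * \prod_(j | j != i) 0 ^+ al j.
have uE h al : c al * \prod_j ((h *: e + a) 0 j - a 0 j) ^+ al j = b al * h ^+ al i.
  rewrite (bigD1 i)//= !mxE !eqxx mulr1 addrK mulrCA mulrC; congr (_ * _ * _).
  by apply: eq_bigr => j ji; rewrite !mxE (negPf ji) mulr0 add0r subrr.
have b0 : b al0 = c al0.
  by rewrite /b big1 ?mulr1// => j _; rewrite ffunE expr0.
have b1 : b al1 = c al1.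
  by rewrite /b big1 ?mulr1// => j ji; rewrite ffunE (negPf ji) expr0.
(* Any other multi-index has degree at least 2 in the i-th variable or
   involves another variable. *)
have bE al : al != al0 -> al != al1 -> b al = 0 \/ (1 < al i)%N.
  move=> a0 a1; have [|ai] := ltnP 1 (al i); first by right.
  left; have [j ji alj] : exists2 j, j != i & al j != 0%N.
    apply/not_exists2P => alj.
    have {}alj j : j != i -> al j = 0%N.
      by move=> ji; apply/eqP; have [|/negP/negPn] := alj j.
    case ali: (al i) ai => [|[|//]] _.
      case/eqP: a0; apply/ffunP => j; rewrite ffunE.
      by have [->|/alj] := eqVneq j i.
    case/eqP: a1; apply/ffunP => j; rewrite ffunE.
    by have [->|/alj] := eqVneq j i.
  by rewrite /b (bigD1 j)//= expr0n (negPf alj) mul0r mulr0.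
pose h0 := r / 2.
have h00 : 0 < h0 by rewrite divr_gt0.
have inball h : `|h| <= h0 -> ball a r (h *: e + a).
  move=> hh; split => // x y; rewrite (ord1 x) !mxE eqxx /= /ball/=.
  rewrite opprD addrCA subrr addr0 normrN normrM.
  rewrite (@le_lt_trans _ _ `|h|)//; first by rewrite ler_piMr// normr_nat lern1 leq_b1.
  by rewrite (le_lt_trans hh)// /h0; lra.
pose w h al : \bar R := (b al * h ^+ al i)%:E.
have Fw h : `|h| <= h0 -> summable setT (w h) /\
   ((F (h *: e + a))%:E = \esum_(al in setT) (w h)^\+ al - \esum_(al in setT) (w h)^\- al)%E.
  move=> /inball/Fr /=.
  rewrite (_ : (fun al => _) = w h)//.
  by apply/funext => al; rewrite uE.
have [sM _] := Fw h0 (ltac:(by rewrite ger0_norm// ltW)).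
have Mfin : (\esum_(al in setT) `|w h0 al|)%E \is a fin_num by rewrite -summableE.
pose M := fine (\esum_(al in setT) `|w h0 al|)%E.
have M0 : 0 <= M by rewrite fine_ge0// esum_ge0.
have bound h : `|h| <= h0 -> `|F (h *: e + a) - c al0 - c al1 * h| <= (h / h0) ^+ 2 * M.
  move=> hh; have [sw Fwh] := Fw h hh.
  have := esum_posneg_two_terms al01 sw Fwh.
  rewrite /w {1}/al0 {1}/al1 !ffunE eqxx expr0 expr1 mulr1 b0 b1 -!EFinB.
  rewrite -lee_fin EFinM fineK// => /le_trans; apply.
  apply: le_esum_scale => [|//|al]; first exact: sqr_ge0.
  move=> /= /not_orP[/eqP a0 /eqP a1].
  rewrite lee_fin -[X in _ <= X * _]ger0_norm ?sqr_ge0// -normrM.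
  have [->|ai] := bE _ a0 a1; first by rewrite !(mul0r, mulr0).
  have -> : al i = (al i - 2).+2 by rewrite -addn2 subnK.
  move: (al i - 2)%N => m.
  have -> : (h / h0) ^+ 2 * (b al * h0 ^+ m.+2) = b al * (h ^+ 2 * h0 ^+ m).
    by rewrite !exprS !expr0; field; rewrite gt_eqF.
  rewrite (_ : h ^+ m.+2 = h ^+ 2 * h ^+ m); last by rewrite -exprD.
  rewrite !normrM !ler_wpM2l//.
  by rewrite !normrX lerXn2r ?nnegrE// (le_trans hh)// ler_norm.
apply/cvg_ex; exists (c al1).
have F0 : F a = c al0.
  have := bound 0 (ltac:(by rewrite normr0 ltW)).
  by rewrite scale0r add0r mulr0 subr0 mul0r expr0n mul0r normr_le0 subr_eq0 => /eqP.
apply/cvgrPdist_le => eps eps0.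
have eM : 0 < eps * h0 ^+ 2 / (M + 1).
  by rewrite divr_gt0 ?mulr_gt0 ?exprn_gt0// ltr_wpDl.
near=> h.
have hn : h != 0 by near: h; exact: nbhs_dnbhs_neq.
have hh : `|h| <= h0 by near: h; exact: dnbhs0_le.
have he : `|h| <= eps * h0 ^+ 2 / (M + 1) by near: h; exact: dnbhs0_le.
rewrite /= F0 (_ : _ - _ = - (h^-1 * (F (h *: e + a) - c al0 - c al1 * h))); last first.
  by rewrite /GRing.scale/=; field.
rewrite normrN normrM normfV ler_pdivrMl ?normr_gt0//.
rewrite (le_trans (bound _ hh))// expr_div_n -real_normK ?num_real//.
rewrite mulrAC ler_pdivrMr ?exprn_gt0// expr2 -!mulrA ler_wpM2l//.
rewrite (le_trans (ler_wpM2r M0 he))// mulrAC ler_pdivrMr ?ltr_wpDl//.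
by rewrite ler_wpM2l ?lerDl// mulr_ge0 ?exprn_ge0// ltW.
Unshelve. all: by end_near. Qed.
End analytic.

(** * A lower bound for the Dunkl kernel *)

Section kernel.
Context {R : realType} {d : nat}.
Variables (k : 'I_d -> R) (E : 'rV[R]_d -> 'rV[R]_d -> R).
Hypothesis k0 : forall i, 0 <= k i.
Hypothesis kE : is_dunkl_kernel k E.

Lemma dunkl_minorant_gt0 (a s : R) : 0 < dunkl_minorant a s.
Proof. by rewrite mulr_gt0 ?expR_gt0// invr_gt0 powR_gt0// lt_max ltr01. Qed.

(** Along the [i]-th axis through a point [p] with [p 0 i = 0], the reflection
    is [u |-> - u], so [T_i F = y_i F] is the rank-one equation. *)
Lemma dunkl_kernel_step (i : 'I_d) (p y : 'rV[R]_d) (s : R) :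
  p 0 i = 0 -> 0 < E p y -> 0 <= s * y 0 i ->
  E p y * dunkl_minorant (k i) (s * y 0 i) <= E (p + s *: delta_mx 0 i) y.
Proof.
move=> pi0 Ep0 sy0; have [anE odeE _] := kE y.
set e : 'rV[R]_d := delta_mx 0 i.
have := @dunkl_ode_lower_bound R (fun u => E (p + u *: e) y)
  (fun u => 'D_e (E^~ y) (p + u *: e)) (k i) (y 0 i) s (k0 i).
rewrite scale0r addr0; apply=> //= u.
  have quotE : (fun h : R => h^-1 *:
      (((fun u => E (p + u *: e) y) \o shift u) (h *: (1:R)) - E (p + u *: e) y))
     = (fun h : R => h^-1 *:
      (((E^~ y) \o shift (p + u *: e)) (h *: e) - E (p + u *: e) y)).
    apply/funext => h /=; congr (_ *: (E _ y - _)).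
    by rewrite /shift/= [h *: 1]mulr1 scalerDl addrCA.
  apply: DeriveDef; rewrite /derivable/derive quotE//.
  exact: real_analytic_derivable.
move=> u0; have := odeE i (p + u *: e).
rewrite /dunkl_op -/e !mxE pi0 add0r !eqxx mulr1 (negPf u0) => <-.
congr (_ + _ * _); rewrite /diff_quotient !mxE !eqxx pi0 mulr1 add0r; congr ((_ - E _ _) / _).
apply/rowP => j; rewrite !mxE eqxx /=.
by have [->|ji] := eqVneq j i; rewrite ?pi0 ?mulr1 ?mulr0 ?add0r ?addr0.
Qed.

(** Induction on the number of coordinates of [x] that have been switched on,
    the remaining ones being set to 0. *)
Lemma dunkl_kernel_ge (x y : 'rV[R]_d) : (forall i, 0 <= x 0 i * y 0 i) ->
  \prod_i dunkl_minorant (k i) (x 0 i * y 0 i) <= E x y.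
Proof.
move=> xy; have [_ _ E1] := kE y.
pose q n : 'rV[R]_d := \row_i (if (i < n)%N then x 0 i else 0).
have H n : (n <= d)%N ->
    \prod_(i < d | (i < n)%N) dunkl_minorant (k i) (x 0 i * y 0 i) <= E (q n) y.
  elim: n => [_|n IH nd].
    rewrite big_pred0// (_ : q 0%N = 0) ?E1//.
    by apply/rowP => i; rewrite !mxE.
  have qS : q n.+1 = q n + x 0 (Ordinal nd) *: delta_mx 0 (Ordinal nd).
    apply/rowP => j; rewrite !mxE ltnS leq_eqVlt eqxx/= -val_eqE/=.
    case: eqVneq => [jn|jn] /=.
      rewrite jn ltnn add0r mulr1; congr (x 0 _); exact: val_inj.
    by rewrite mulr0 addr0.
  have {}IH := IH (ltnW nd).
  have P0 : 0 < \prod_(i < d | (i < n)%N) dunkl_minorant (k i) (x 0 i * y 0 i).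
    by apply: prodr_gt0 => i _; exact: dunkl_minorant_gt0.
  have qn0 : q n 0 (Ordinal nd) = 0 by rewrite !mxE ltnn.
  rewrite qS; apply: le_trans (dunkl_kernel_step qn0 (lt_le_trans P0 IH) (xy _)).
  rewrite (bigD1 (Ordinal nd))//= mulrC ler_wpM2r ?(ltW (dunkl_minorant_gt0 _ _))//.
  apply: (le_trans _ IH); rewrite le_eqVlt; apply/orP; left; apply/eqP.
  apply: eq_bigl => j; rewrite -val_eqE/= ltnS.
  by rewrite [in RHS]ltn_neqAle andbC.
have := H d (leqnn d).
rewrite (_ : q d = x); last by apply/rowP => i; rewrite mxE ltn_ord.
apply: le_trans; rewrite le_eqVlt; apply/orP; left; apply/eqP.
by apply: eq_bigl => i; rewrite ltn_ord.
Qed.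
End kernel.

(** * Lower bounds for integrals and the volume of a cube *)

Section integral_lower_bound.
Context {d : measure_display} {T : measurableType d} {R : realType}.
Variable mu : {measure set T -> \bar R}.

(** The integral of a nonnegative function is a supremum over the simple
    functions below it, which gives the bound for arbitrary [f]. This generality
    matters here: a Dunkl kernel is characterised through its first argument
    only, while the semigroup integrates over the second one. *)
Lemma integral_ge_cst (B : set T) (f : T -> \bar R) (c : R) :
  measurable B -> 0 <= c -> (forall x, B x -> c%:E <= f x)%E ->
  (c%:E * mu B <= \int[mu]_(x in B) f x)%E.
Proof.
move=> mB c0 cf; rewrite -integral_cst// !ge0_integralE//; last first.
  by move=> x Bx; apply: le_trans (cf x Bx); rewrite lee_fin.
apply: ereal_sup_le => _ [h /= hc <-]; exists h => //= x.
apply: (le_trans (hc x)); rewrite !patchE; case: ifPn => // xB.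
by apply: cf; rewrite inE in xB.
Qed.
End integral_lower_bound.

Section ball_measure.
Context {R : realType}.

Lemma lebesgue_rV_ball n (c : 'rV[R]_n) (r : R) : 0 < r ->
  lebesgue_rV n (ball c r) = ((r *+ 2) ^+ n)%:E.
Proof.
move=> r0; elim: n c => [|n IH] c /=.
  rewrite /= diracE mem_set//; split => // i; by case.
rewrite /lebesgue_step /pushforward.
have -> : @consr R n @^-1` ball c r = ball (c 0 0) r `*` ball (unconsr c).2 r.
  apply/seteqP; split => [[x v] [_ h]|[x v] [/= hx [_ hv]]].
    split => /=.
      have := h 0 0; rewrite /consr mxE; case: splitP => //= j _.
      by rewrite mxE.
    split=> // i j; have := h 0 (lift ord0 j); rewrite !mxE (ord1 i).
    case: splitP => [j' /= | l /= [jl]]; first by rewrite (ord1 j').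
    by move: (ord_inj jl) => ->.
  split=> // i j; rewrite (ord1 i) /consr mxE; case: splitP => l /= jl.
    rewrite mxE (_ : j = 0)//; apply: val_inj => /=; by rewrite jl (ord1 l).
  have := hv 0 l; rewrite mxE (_ : lift ord0 l = j)//.
  by apply: val_inj; rewrite /= jl.
rewrite product_measure1E; last 2 first.
- by apply: open_measurable; exact: ball_open.
- by apply: open_measurable_mx; exact: ball_open.
rewrite [X in (X * _)%E](_ : _ = (r *+ 2)%:E); last first.
  exact: (lebesgue_measure_ball _ (ltW r0)).
by rewrite IH -EFinM exprS.
Qed.
End ball_measure.

Section coordinate.
Context {R : realType}.

(** A displacement of at most half of [|z|] keeps the sign of [z]; all three
    bounds follow from [0 <= z ^ 2 / 2 + z w]. *)
Lemma small_perturbation (z w : R) : `|w| <= `|z| / 2 ->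
  [/\ 0 <= z * (z + w), z * (z + w) / 2 <= (z + w) ^+ 2 &
      z ^+ 2 / 4 <= (z + w) ^+ 2].
Proof.
move=> wz.
have K : 0 <= z ^+ 2 / 2 + z * w.
  rewrite -lerBlDr sub0r (le_trans (ler_norm _))// normrN normrM -real_normK ?num_real//.
  by rewrite expr2 -mulrA ler_wpM2l.
have S := sqr_ge0 (z / 2 + w); have Z := sqr_ge0 z.
by split; nra.
Qed.

(** Writing [m = max(1, z y / s^2)], the right-hand side is
    [exp(- u^2 / 2 - 1) * (y^2 / (s^2 m))^a], so it suffices that [y ^ 2]
    dominates both [s ^ 2] and [z y]. If [z = 0] then [y = s u] and this
    follows from [|u| >= e]; otherwise [s] is small compared with [z], and [y]
    is comparable with [z]. *)
Lemma coordinate_density_ge (a z u s e M : R) : 0 <= a -> 0 < s -> 0 < e ->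
  e <= `|u| -> `|u| <= M -> (z != 0 -> s * (2 * (M + 1)) <= `|z|) ->
  0 <= z * (z + s * u) /\
  expR (- (M ^+ 2 / 2) - 1) * Num.min (1 / 2) (e ^+ 2) `^ a <=
  ((s ^+ 2) `^ a)^-1 * expR (- ((z ^+ 2 + (z + s * u) ^+ 2) / (2 * s ^+ 2))) *
  dunkl_minorant a (z * (z + s * u) / s ^+ 2) * `|z + s * u| `^ (2 * a).
Proof.
move=> a0 s0 e0 eu uM zs; set y := z + s * u; set dl := Num.min _ _.
have M0 : 0 <= M by apply: le_trans uM.
have s20 : 0 < s ^+ 2 by rewrite exprn_gt0.
have dl0 : 0 < dl by rewrite lt_min exprn_gt0 ?divr_gt0.
have dl2 : dl <= 1 / 2 by rewrite ge_min lexx.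
have dle : dl <= e ^+ 2 by rewrite ge_min lexx orbT.
have [zy zy2 sy2] : [/\ 0 <= z * y, dl * (z * y) <= y ^+ 2 & dl * s ^+ 2 <= y ^+ 2].
  have [z0|z0] := eqVneq z 0.
    rewrite /y z0 !mul0r mulr0 add0r; split; rewrite ?sqr_ge0//.
    rewrite exprMn [leLHS]mulrC ler_pM2l//.
    by rewrite (le_trans dle)// -(@real_normK _ u) ?num_real// lerXn2r ?nnegrE// ltW.
  have {}zs := zs z0.
  have := @small_perturbation z (s * u); rewrite -/y => -[|zy zy2 y2].
    rewrite normrM gtr0_norm// ler_pdivlMr// -mulrA (le_trans _ zs)// ler_wpM2l ?(ltW s0)//.
    lra.
  split => //.
    by rewrite (le_trans _ zy2)// mulrC ler_wpM2l//; lra.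
  rewrite (le_trans _ y2)// (@le_trans _ _ (s ^+ 2))//.
    by rewrite ler_piMl ?(ltW s20)//; lra.
  rewrite ler_pdivlMr// -(@real_normK _ z) ?num_real//.
  rewrite (_ : s ^+ 2 * 4 = (s * 2) ^+ 2); last by ring.
  rewrite lerXn2r ?nnegrE ?mulr_ge0 ?(ltW s0)// (le_trans _ zs)// ler_pM2l//; lra.
split => //.
rewrite /dunkl_minorant.
set m := Num.max _ _.
have m1 : 1 <= m by rewrite le_max lexx.
have m0 : 0 < m by rewrite (lt_le_trans _ m1).
have -> : `|y| `^ (2 * a) = (y ^+ 2) `^ a.
  by rewrite powRrM powR_mulrn// real_normK ?num_real.
have yb : dl `^ a * ((s ^+ 2) `^ a * m `^ a) <= (y ^+ 2) `^ a.
  have sm0 : 0 <= s ^+ 2 * m by apply: mulr_ge0; exact: ltW.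
  rewrite -(powRM _ (ltW s20) (ltW m0)) -(powRM _ (ltW dl0) sm0).
  rewrite ge0_ler_powR ?nnegrE ?sqr_ge0//.
    by apply: mulr_ge0; first exact: ltW.
  rewrite /m; have [_|_] := leP 1 (z * y / s ^+ 2); last by rewrite mulr1.
  by rewrite (mulrC (s ^+ 2)) divfK ?gt_eqF.
have P0 : 0 < (s ^+ 2) `^ a * m `^ a by rewrite mulr_gt0 ?powR_gt0.
have yb' : dl `^ a <= (y ^+ 2) `^ a / ((s ^+ 2) `^ a * m `^ a).
  by rewrite ler_pdivlMr.
rewrite [leRHS](_ : _ = expR (- (u ^+ 2 / 2) - 1) * ((y ^+ 2) `^ a / ((s ^+ 2) `^ a * m `^ a))).
  apply: ler_pM yb'; rewrite ?expR_ge0 ?powR_ge0//.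
  rewrite ler_expR lerD2r lerN2 ler_pM2r ?invr_gt0//.
  by rewrite -(@real_normK _ u) ?num_real// lerXn2r ?nnegrE.
have -> : expR (- (u ^+ 2 / 2) - 1) =
  expR (- ((z ^+ 2 + y ^+ 2) / (2 * s ^+ 2))) * expR (z * y / s ^+ 2 - 1).
  rewrite -expRD; congr expR; rewrite /y; field; by rewrite gt_eqF.
by field; rewrite !gt_eqF ?powR_gt0.
Qed.
End coordinate.

(** * The semigroup charges scaled boxes uniformly *)

Section density.
Context {R : realType} {d : nat}.
Variables (k : 'I_d -> R) (E : 'rV[R]_d -> 'rV[R]_d -> R).
Hypothesis k0 : forall i, 0 <= k i.
Hypothesis kE : is_dunkl_kernel k E.

Lemma powR_sum (I : Type) (r : seq I) (f : I -> R) (t : R) : 0 < t ->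
  t `^ (\sum_(i <- r) f i) = \prod_(i <- r) t `^ f i.
Proof.
move=> t0; elim: r => [|i r IH]; first by rewrite !big_nil powRr0.
by rewrite !big_cons powRD ?IH// (gt_eqF t0) implybT.
Qed.

Lemma sqr_enorm (x : 'rV[R]_d) : enorm x ^+ 2 = \sum_i x 0 i ^+ 2.
Proof. by rewrite sqr_sqrtr// sumr_ge0// => i _; rewrite sqr_ge0. Qed.

(** Apart from the kernel, the density with respect to Lebesgue measure is a
    product over coordinates; the time is written [s ^ 2] to have [s] as the
    space scale. *)
Lemma dunkl_density_prodE (s : R) (x y : 'rV[R]_d) : 0 < s ->
  dunkl_density k E (s ^+ 2) x y * weight k y =
  (dunkl_cst k * s ^+ d)^-1 *
  (E (s^-1 *: x) (s^-1 *: y) *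
  \prod_i (((s ^+ 2) `^ k i)^-1 * expR (- ((x 0 i ^+ 2 + y 0 i ^+ 2) / (2 * s ^+ 2)))
     * `|y 0 i| `^ (2 * k i))).
Proof.
move=> s0; have s20 : 0 < s ^+ 2 by rewrite exprn_gt0.
rewrite /dunkl_density /weight sqrtr_sqr gtr0_norm//.
rewrite powRD ?(gt_eqF s20) ?implybT// /gammak powR_sum//.
have -> : (s ^+ 2) `^ (d%:R / 2) = s ^+ d.
  rewrite -powR_mulrn ?(ltW s0)// -powRrM mulrC divfK ?pnatr_eq0//.
  by rewrite powR_mulrn// ltW.
rewrite !sqr_enorm -big_split/= mulr_suml -sumrN expR_sum.
rewrite !big_split/= prodfV.
rewrite !invfM; ring.
Qed.

Lemma dunkl_density_weight_ge (s e M : R) (z u : 'rV[R]_d) :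
  0 < dunkl_cst k -> 0 < s -> 0 < e ->
  (forall i, e <= `|u 0 i| /\ `|u 0 i| <= M) ->
  (forall i, z 0 i != 0 -> s * (2 * (M + 1)) <= `|z 0 i|) ->
  (dunkl_cst k * s ^+ d)^-1 *
   \prod_i (expR (- (M ^+ 2 / 2) - 1) * Num.min (1 / 2) (e ^+ 2) `^ k i) <=
  dunkl_density k E (s ^+ 2) z (z + s *: u) * weight k (z + s *: u).
Proof.
move=> ck0 s0 e0 uM zs.
rewrite dunkl_density_prodE// ler_wpM2l//.
  by rewrite invr_ge0 mulr_ge0 ?exprn_ge0// ltW.
have C i := coordinate_density_ge (k0 i) s0 e0 (uM i).1 (uM i).2 (zs i).
have yE i : (z + s *: u) 0 i = z 0 i + s * u 0 i by rewrite !mxE.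
have ip i : (s^-1 *: z) 0 i * (s^-1 *: (z + s *: u)) 0 i =
    z 0 i * (z 0 i + s * u 0 i) / s ^+ 2.
  by rewrite !mxE; field; rewrite gt_eqF.
have Ege : \prod_i dunkl_minorant (k i) (z 0 i * (z 0 i + s * u 0 i) / s ^+ 2) <=
    E (s^-1 *: z) (s^-1 *: (z + s *: u)).
  under eq_bigr do rewrite -ip.
  apply: dunkl_kernel_ge => // i; rewrite ip divr_ge0 ?sqr_ge0//.
  by have [] := C i.
apply: le_trans (ler_wpM2r _ Ege); last first.
  by apply: prodr_ge0 => i _; rewrite !mulr_ge0 ?invr_ge0 ?powR_ge0 ?expR_ge0.
rewrite -big_split/=; apply: ler_prod => i _; apply/andP; split.
  by rewrite mulr_ge0 ?powR_ge0 ?expR_ge0.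
rewrite yE; have [_ h] := C i; apply: (le_trans h).
by rewrite le_eqVlt; apply/orP; left; apply/eqP; ring.
Qed.

Lemma ball_rescale (z q : 'rV[R]_d) (s e : R) (y : 'rV[R]_d) : 0 < s ->
  ball (z + s *: q) (s * e) y ->
  exists2 u, y = z + s *: u & forall i, `|u 0 i - q 0 i| < e.
Proof.
move=> s0 [_ hy]; exists (s^-1 *: (y - z)).
  by rewrite scalerA divff ?gt_eqF// scale1r addrCA subrr addr0.
move=> i; have := hy 0 i; rewrite /ball/= !mxE => hyi.
rewrite -(ltr_pM2l s0) -[X in X * _ < _](gtr0_norm s0) -normrM.
rewrite (_ : s * _ = y 0 i - (z 0 i + s * q 0 i)) 1?distrC//.
by field; rewrite gt_eqF.
Qed.

(** The factor [s ^ (- d)] of the density cancels against the volume of the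
    ball, which is a cube for the sup norm; the bound is independent of [s]
    and [z]. *)
Lemma dunkl_semigroup_scaled_ball_ge (s e M : R) (z q : 'rV[R]_d) :
  0 < dunkl_cst k -> 0 < s -> 0 < e ->
  (forall i, 2 * e <= `|q 0 i| /\ `|q 0 i| + e <= M) ->
  (forall i, z 0 i != 0 -> s * (2 * (M + 1)) <= `|z 0 i|) ->
  (((dunkl_cst k)^-1 * (e *+ 2) ^+ d *
   \prod_i (expR (- (M ^+ 2 / 2) - 1) * Num.min (1 / 2) (e ^+ 2) `^ k i))%:E <=
  dunkl_semigroup k E (s ^+ 2) z (ball (z + s *: q)%R (s * e)%R))%E.
Proof.
move=> ck0 s0 e0 qM zs.
set c := \prod_i _.
have c0 : 0 <= c by apply: prodr_ge0 => i _; rewrite mulr_ge0 ?powR_ge0 ?expR_ge0.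
have cc0 : 0 <= (dunkl_cst k * s ^+ d)^-1 * c.
  by rewrite mulr_ge0// invr_ge0 mulr_ge0 ?exprn_ge0// ltW.
apply: (@le_trans _ _ (((dunkl_cst k * s ^+ d)^-1 * c)%:E *
    lebesgue_rV d (ball (z + s *: q)%R (s * e)%R))%E); last first.
  apply: integral_ge_cst => //.
    by apply: open_measurable_mx; exact: ball_open.
  move=> y /(ball_rescale s0)[u -> uq]; rewrite lee_fin.
  apply: dunkl_density_weight_ge => // i.
  have [q1 q2] := qM i; have := uq i => uqi.
  have n1 : `|q 0 i| <= `|u 0 i| + `|u 0 i - q 0 i|.
    by rewrite -{1}(subKr (u 0 i) (q 0 i)) ler_normB.
  have n2 : `|u 0 i| <= `|u 0 i - q 0 i| + `|q 0 i|.
    by rewrite -{1}(subrK (q 0 i) (u 0 i)) ler_normD.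
  by split; lra.
rewrite lebesgue_rV_ball ?mulr_gt0// -EFinM lee_fin.
rewrite -mulrnAr exprMn.
rewrite le_eqVlt; apply/orP; left; apply/eqP; field.
by rewrite !gt_eqF ?exprn_gt0.
Qed.
End density.

(** * The zero-one argument at time zero *)

Section sigma.
Context {T : Type} (G : set (set T)).
Hypothesis sG : sigma_algebra setT G.

Lemma sigma_algebra_setC (A : set T) : G A -> G (~` A).
Proof. by have [_ GC _] := sG; move/GC; rewrite setTD. Qed.

Lemma sigma_algebra_bigcup_nat (A : (set T)^nat) :
  (forall n, G (A n)) -> G (\bigcup_n A n).
Proof. by have [_ _] := sG; exact. Qed.

Lemma sigma_algebra_bigcap_nat (A : (set T)^nat) :
  (forall n, G (A n)) -> G (\bigcap_n A n).
Proof.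
move=> GA; rewrite -[X in G X]setCK setC_bigcap.
apply: sigma_algebra_setC; apply: sigma_algebra_bigcup_nat => n.
exact: sigma_algebra_setC.
Qed.

Lemma sigma_algebra_setI_mem (A B : set T) : G A -> G B -> G (A `&` B).
Proof.
move=> GA GB; rewrite -bigcap2E; apply: sigma_algebra_bigcap_nat => n.
rewrite /bigcap2; case: ifP => // _; case: ifP => // _.
by have [G0 _ _] := sG; rewrite -setC0; exact: sigma_algebra_setC.
Qed.
End sigma.

Section zero_one.
Context {R : realType} {d : nat} {dO : measure_display} {Omega : measurableType dO}.
Variables (Q : R -> 'rV[R]_d -> set 'rV[R]_d -> \bar R).
Variables (F : R -> set (set Omega)) (X : R -> Omega -> 'rV[R]_d)
  (P : 'rV[R]_d -> probability Omega R).
Hypothesis H : is_hunt_process Q F X P.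

Lemma measurable_rV1 (z : 'rV[R]_d) : measurable [set z].
Proof.
have -> : [set z] =
    \bigcap_(i in [set: 'I_d]) (fun v : 'rV[R]_d => v 0 i) @^-1` [set z 0 i].
  apply/seteqP; split => [v /= -> i _ //|v h]; apply/rowP => i; exact: (h i I).
apply: fin_bigcap_measurable => // i _.
rewrite -[X in measurable X]setTI.
apply: (@continuous_measurable_mx R 1 d) => //; exact: coord_continuous.
Qed.

Let F_le s t : 0 <= s -> s <= t -> F s `<=` F t.
Proof. by have [_ _ h] := hunt_filtration H; exact: h. Qed.

Let sF t : 0 <= t -> sigma_algebra setT (F t).
Proof. by have [h _ _] := hunt_filtration H; exact: h. Qed.

Let F_mb t : 0 <= t -> F t `<=` measurable.
Proof. by have [_ h _] := hunt_filtration H; exact: h. Qed.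

Lemma start_in_F0 z : F 0 (X 0 @^-1` [set z]).
Proof. by apply: (hunt_adapted H) => //; exact: measurable_rV1. Qed.

(** The Markov property at time 0. Restricting to an event on which the start
    is exactly [z] makes the integrand literally constant, whereas an integrand
    that is constant almost surely would call for the measurability of
    [Q s x B] in [x]. *)
Lemma markov_at_zero (z : 'rV[R]_d) (A : set Omega) (s : R) (B : set 'rV[R]_d) :
  F 0 A -> A `<=` X 0 @^-1` [set z] -> 0 < s -> measurable B ->
  (P z (A `&` X s @^-1` B) = Q s z B * P z A)%E.
Proof.
move=> FA Az s0 mB.
have := @hunt_strong_markov _ _ _ _ _ _ _ _ H z (fun=> 0%E) s A B.
have E0 : A `&` [set w : Omega | (0 < +oo :> \bar R)%E] = A.
  by apply/seteqP; split => [w []//|w Aw]; split=> //=; exact: ltry.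
rewrite /= E0 add0r => ->//; last 2 first.
- split => // t t0; rewrite (_ : [set _ | _] = setT).
    rewrite -setC0; apply: sigma_algebra_setC; first exact: sF.
    by have [] := sF t0.
  by apply/seteqP; split => // w _ /=; rewrite lee_fin.
- split; first exact: F_mb FA.
  move=> t t0; rewrite (_ : [set _ | _] = setT) ?setIT; first exact: F_le FA.
  by apply/seteqP; split => // w _ /=; rewrite lee_fin.
rewrite -integral_cst; last exact: F_mb FA.
by apply: eq_integral => w; rewrite inE => /Az /= ->.
Qed.

(** A form of the zero-one law for the event [L] that the hits recur: it is in
    [F 0] because it only depends on arbitrarily small times and the filtration
    is right-continuous. On [~` L] the hits stop, so
    [P z (~` L `&` {X (t n) \in B n})] tends to 0; but by the Markov property
    at time 0 it is at least [c * P z (~` L)]. Hence [~` L] is null. *)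
Lemma hits_infinitely_often (z : 'rV[R]_d) (t : R^nat)
    (B : (set 'rV[R]_d)^nat) (c : R) :
  (forall n, 0 < t n) -> t @ \oo --> 0 -> (forall n, measurable (B n)) ->
  0 < c -> (forall n, c%:E <= Q (t n) z (B n))%E ->
  {ae P z, forall w, forall N, exists2 n, (N <= n)%N & B n (X (t n) w)}.
Proof.
move=> t0 tcvg mB c0 cQ.
pose G n := X (t n) @^-1` B n.
pose L := \bigcap_N \bigcup_n G (n + N)%N.
have FL : F 0 L.
  rewrite (hunt_right_continuous H)// => s /= s0.
  have [N0 _ tN0] : \forall n \near \oo, t n < s by move/cvgr_lt : tcvg; exact.
  (* Dropping the first N0 times does not change L. *)
  have -> : L = \bigcap_N \bigcup_n G (n + (N + N0))%N.
    apply/seteqP; split => w h N _; first exact: (h (N + N0)%N).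
    by have [n _ Gn] := h N I; exists (n + N0)%N => //; rewrite -addnA (addnC N0).
  apply: sigma_algebra_bigcap_nat; first exact/sF/ltW.
  move=> N; apply: sigma_algebra_bigcup_nat; first exact/sF/ltW.
  move=> n; apply: (@F_le (t (n + (N + N0))%N)); first exact/ltW.
    by apply/ltW/tN0; rewrite /= addnA leq_addl.
  by apply: (hunt_adapted H) => //; exact/ltW.
pose A := ~` L `&` X 0 @^-1` [set z].
have FA : F 0 A.
  apply: sigma_algebra_setI_mem; first exact: sF.
    by apply: sigma_algebra_setC => //; exact: sF.
  exact: start_in_F0.
have mA := F_mb (lexx 0) FA.
have mG n : measurable (G n).
  by apply: (F_mb (ltW (t0 n))); apply: (hunt_adapted H) => //; exact/ltW.
have PS n : (c%:E * P z A <= P z (A `&` G n))%E.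
  by rewrite (@markov_at_zero z A (t n) (B n)) ?lee_wpmul2r//; move=> w [].
pose U m := \bigcup_n (A `&` G (n + m)%N).
have mU m : measurable (U m).
  by apply: bigcupT_measurable => n; exact: measurableI.
have U0 : \bigcap_m U m = set0.
  rewrite -subset0 => w h.
  have [_ _ [[nL _] _]] := h 0%N I.
  by apply: nL => N _; have [n _ [_ Gn]] := h N I; exists n.
have Ucvg : P z \o U @ \oo --> P z (\bigcap_m U m).
  apply: nonincreasing_cvg_mu => //.
  - by rewrite (le_lt_trans (probability_le1 _ _))// ltry.
  - by rewrite U0.
  - move=> m n mn; apply/subsetPset => w [j _ [Aw Gw]].
    by exists (j + (n - m))%N => //; rewrite -addnA subnK.
rewrite U0 measure0 in Ucvg.
have PA : P z A = 0%E.
  apply/eqP; rewrite -measure_le0 -(@lee_pmul2l _ c%:E)// mule0.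
  rewrite -(cvg_lim _ Ucvg)//; apply: lime_ge; first by apply/cvg_ex; exists 0%E.
  near=> m; apply: (le_trans (PS m)); apply: le_measure; rewrite ?inE//.
    exact: measurableI.
  by move=> w [Aw Gw]; exists 0%N.
have aeA : {ae P z, forall w, ~ A w}.
  by exists A; split => //; move=> w /= /contrapT.
have aeX := hunt_start H z.
apply: filterS2 aeA aeX => w nA Xz N.
have Lw : L w by apply: contrapT => nL; apply: nA; split.
by have [n _ Gn] := Lw N I; exists (n + N)%N => //; rewrite leq_addl.
Unshelve. all: by end_near. Qed.

Lemma semigroup_mass1 (z : 'rV[R]_d) (s : R) : 0 < s -> Q s z setT = 1%E.
Proof.
move=> s0; have := markov_at_zero (start_in_F0 z) (@subset_refl _ _) s0 measurableT.
rewrite preimage_setT setIT.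
suff -> : P z (X 0 @^-1` [set z]) = 1%E by rewrite mule1.
have mX := F_mb (lexx 0) (start_in_F0 z).
have := probability_setC (P z) mX.
rewrite (_ : P z (~` _) = 0%E).
  by move=> /esym/eqP; rewrite sube_eq ?fin_num_measure// add0e => /eqP <-.
by apply: measure_negligible; [exact: measurableC | exact: (hunt_start H z)].
Qed.

End zero_one.

Lemma exit_time_eq0 {R : realType} {d : nat} {dO : measure_display}
  {Omega : measurableType dO} (X : R -> Omega -> 'rV[R]_d) (D : set 'rV[R]_d)
  (w : Omega) : (forall e, 0 < e -> exists2 t, 0 < t <= e & ~ D (X t w)) ->
  exit_time X D w = 0%E.
Proof.
move=> h; apply/eqP; rewrite eq_le; apply/andP; split; last first.
  by apply: le_ereal_inf_tmp => _ /= [t [t0 _] <-]; rewrite lee_fin ltW.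
apply/lee_addgt0Pr => e e0; rewrite add0e.
have [t /andP[t0 te] nD] := h e e0.
apply: (@le_trans _ _ t%:E); last by rewrite lee_fin.
by apply: ereal_inf_lbound; exists t.
Qed.

(** * Boxes inside a cone and regularity *)

Section cone_box.
Context {R : realType} {d : nat}.
Implicit Types (z p q u : 'rV[R]_d).

(** If the normalising integral were 0 (in particular if it diverged, the real
    value being 0 by convention), the density would vanish identically,
    contradicting the total mass 1. *)
Lemma dunkl_cst_gt0 (k : 'I_d -> R) (E : 'rV[R]_d -> 'rV[R]_d -> R) z (s : R) :
  dunkl_semigroup k E s z setT = 1%E -> 0 < dunkl_cst k.
Proof.
move=> Q1; rewrite lt_neqAle; apply/andP; split; last first.
  apply: Rintegral_ge0 => y _; rewrite mulr_ge0 ?expR_ge0//.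
  by apply: prodr_ge0 => i _; exact: powR_ge0.
apply/eqP => c0; move: Q1; rewrite /dunkl_semigroup.
under eq_integral do rewrite /dunkl_density -c0 mul0r invr0 !mul0r.
by rewrite integral0 => /eqP; rewrite eq_sym onee_eq0.
Qed.

(** Starting from an interior point [p] of the cone, each coordinate is moved
    away from that of [z] by half the radius of a ball around [p] inside the
    cone; this keeps the box off the coordinate hyperplanes through [z]. *)
Lemma interior_cone_generic_box z (C : set 'rV[R]_d) : cone_with_vertex z C ->
  exists q (e : R), [/\ 0 < e, forall i, 2 * e <= `|q 0 i| &
    forall u s, (forall i, `|u 0 i - q 0 i| < e) -> 0 < s -> C (z + s *: u)].
Proof.
move=> [[p /nbhs_ballP[rho /= rho0 pC]] Ccone].
pose q : 'rV[R]_d :=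
  \row_i (p 0 i - z 0 i + (if z 0 i <= p 0 i then rho / 2 else - (rho / 2))).
exists q, (rho / 4); split; first by rewrite divr_gt0.
  move=> i; rewrite mxE; case: (leP (z 0 i) (p 0 i)) => h.
    by apply: le_trans (ler_norm _); lra.
  by rewrite -normrN; apply: le_trans (ler_norm _); lra.
move=> u s uq s0.
have -> : z + s *: u = z + s *: ((z + u) - z) by rewrite [z + u]addrC addrK.
apply: Ccone => //; apply: pC; split=> // i j; rewrite (ord1 i) /ball/= !mxE.
have := uq j; rewrite !mxE !ltr_norml => /andP[u1 u2].
by move: u1 u2; case: ifP => _ u1 u2; apply/andP; split; lra.
Qed.

Lemma enorm_lt u (M r : R) : (forall i, `|u 0 i| <= M) -> 0 <= M ->
  M * d.+1%:R < r -> enorm u < r.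
Proof.
move=> uM M0 Mr; apply: le_lt_trans Mr.
rewrite -(@ler_pXn2r _ 2)// ?nnegrE ?sqrtr_ge0 ?mulr_ge0// sqr_enorm.
apply: (@le_trans _ _ (\sum_(i < d) M ^+ 2)).
  by apply: ler_sum => i _; rewrite -real_normK ?num_real// lerXn2r ?nnegrE.
rewrite sumr_const card_ord -[leLHS]mulr_natr exprMn ler_wpM2l ?sqr_ge0//.
by rewrite -natrX ler_nat (leq_trans (leqnSn d))// -mulnn leq_pmulr.
Qed.

End cone_box.

Theorem theorem7 (R : realType) (d : nat) (k : 'I_d -> R)
    (E : 'rV[R]_d -> 'rV[R]_d -> R)
    (dO : measure_display) (Omega : measurableType dO)
    (F : R -> set (set Omega)) (X : R -> Omega -> 'rV[R]_d)
    (P : 'rV[R]_d -> probability Omega R)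
    (D : set 'rV[R]_d) (z : 'rV[R]_d) :
  (1 <= d)%N ->
  (forall i, 0 <= k i) ->
  0 < lambdak k ->
  is_dunkl_kernel k E ->
  is_hunt_process (dunkl_semigroup k E) F X P ->
  open D -> bounded_set D ->
  frontier D z ->
  (exists (C : set 'rV[R]_d) (r : R),
     [/\ cone_with_vertex z C, 0 < r & C `&` eball z r `<=` ~` D]) ->
  regular_point X P D z.
Proof.
move=> _ k0 _ kE H _ _ _ [C [r [Ccone r0 CD]]].
have [q [e [e0 qe qC]]] := interior_cone_generic_box Ccone.
have ck0 : 0 < dunkl_cst k.
  exact: (dunkl_cst_gt0 (semigroup_mass1 H z (ltr01 : 0 < 1))).
(* M bounds every coordinate of the points of the box. *)
pose M := \sum_i `|q 0 i| + e.
have qM i : `|q 0 i| + e <= M.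
  by rewrite lerD2r (bigD1 i)//= lerDl sumr_ge0.
have M0 : 0 < M by rewrite ltr_wpDl// sumr_ge0.
(* At scales below s0, a nonzero coordinate of z is hardly moved and the scaled
   box is inside the Euclidean ball of radius r. *)
have [s0 /= [s00 s0z s0r]] : exists s0 : R, [/\ 0 < s0,
    forall i, z 0 i != 0 -> s0 * (2 * (M + 1)) <= `|z 0 i| &
    s0 * (M * d.+1%:R) < r].
  have : \forall s \near (0:R)^'+, [/\ 0 < s,
    forall i, z 0 i != 0 -> s * (2 * (M + 1)) <= `|z 0 i| &
    s * (M * d.+1%:R) < r].
    have M2 : 0 < M * d.+1%:R by rewrite mulr_gt0.
    near=> s; split.
    - by near: s; exact: nbhs_right_gt.
    - near: s; apply: filter_forall => i.
      have M1 : 0 < 2 * (M + 1) by rewrite mulr_gt0// addr_gt0.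
      have [->|zi] := eqVneq (z 0 i) 0; first by near=> s.
      near=> s => _; rewrite -ler_pdivlMr//; near: s.
      by apply: nbhs_right_le; rewrite divr_gt0// normr_gt0.
    - rewrite -ltr_pdivlMr//; near: s.
      by apply: nbhs_right_lt; rewrite divr_gt0.
  by move=> /filter_ex.
pose s n := s0 * harmonic n.
have sgt n : 0 < s n by rewrite mulr_gt0// invr_gt0 ltr0n.
have sle n : s n <= s0.
  by rewrite ler_piMr ?(ltW s00)// invf_le1 ?ltr0n// ler1n.
have scvg : (fun n => s n ^+ 2) @ \oo --> (0:R).
  have h1 : s n @[n --> \oo] --> (0:R).
    by rewrite -(mulr0 s0); apply: cvgM; [exact: cvg_cst | exact: cvg_harmonic].
  by rewrite -(mulr0 (0:R)); under eq_fun do rewrite expr2; exact: cvgM.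
pose B n := ball (z + s n *: q) (s n * e).
have BD n : B n `<=` ~` D.
  move=> y /(ball_rescale (sgt n))[u -> uq]; apply: CD; split; first exact: qC.
  rewrite /eball/= addrC addKr.
  have uM i : `|u 0 i| <= M.
    have n2 : `|u 0 i| <= `|u 0 i - q 0 i| + `|q 0 i|.
      by rewrite -{1}(subrK (q 0 i) (u 0 i)) ler_normD.
    have := qM i; have := uq i; lra.
  apply: (@enorm_lt _ _ _ (s0 * M)); last by rewrite -mulrA.
    move=> i; rewrite mxE normrM gtr0_norm//.
    by apply: ler_pM => //; exact: ltW.
  by rewrite mulr_ge0// ltW.
pose c := (dunkl_cst k)^-1 * (e *+ 2) ^+ d *
   \prod_i (expR (- (M ^+ 2 / 2) - 1) * Num.min (1 / 2) (e ^+ 2) `^ k i).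
have c0 : 0 < c.
  rewrite !mulr_gt0 ?invr_gt0 ?exprn_gt0 ?pmulrn_lgt0//.
  apply: prodr_gt0 => i _; rewrite mulr_gt0 ?expR_gt0// powR_gt0//.
  by rewrite lt_min exprn_gt0// divr_gt0.
have hit := @hits_infinitely_often _ _ _ _ _ _ _ _ H z (fun n => s n ^+ 2) B c
  (fun n => exprn_gt0 2 (sgt n)) scvg.
have {}hit := hit (fun n => open_measurable_mx (ball_open _ _)) c0.
have {hit} : {ae P z, forall w N, exists2 n, (N <= n)%N & B n (X (s n ^+ 2) w)}.
  apply: hit => n; apply: dunkl_semigroup_scaled_ball_ge => //.
  move=> i zi; apply: le_trans (s0z i zi); rewrite ler_wpM2r//.
  by rewrite mulr_ge0// addr_ge0// ltW.
apply: filterS => w hit; apply: exit_time_eq0 => eps eps0.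
have [N _ sN] : \forall n \near \oo, s n ^+ 2 < eps by move/cvgr_lt : scvg; exact.
have [n Nn Bn] := hit N; exists (s n ^+ 2).
  by rewrite exprn_gt0//= ltW// sN.
exact: BD Bn.
Unshelve. all: by end_near. Qed.
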